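(* Let $n\ge 1$, $\lambda>0$ and $\sigma_1\ge\dots\ge\sigma_{n-1}\ge 1$, let $\mu$ be the Lorentzian inner product $\operatorname{diag}\{\sigma_1,\sigma_1,\dots,\sigma_{n-1},\sigma_{n-1},1,1,-\lambda\}$ on the Heisenberg Lie algebra $\mathfrak{h}_{2n+1}$ in the basis $\{f_1,g_1,\dots,f_n,g_n,z\}$, and let $\mathscr{B}=\{v_1,\dots,v_{2n+1}\}$ be the orthonormal basis given by $v_{2k-1}=\frac{1}{\sqrt{\sigma_k}}f_k$, $v_{2k}=\frac{1}{\sqrt{\sigma_k}}g_k$ for $1\le k\le n-1$, $v_{2n-1}=f_n$, $v_{2n}=g_n$, $v_{2n+1}=\frac{1}{\sqrt{\lambda}}z$. Then the Ricci operator of $(\mathfrak{h}_{2n+1},\mu)$ is represented in the basis $\mathscr{B}$ by the diagonal matrix $$\operatorname{Ric}=\operatorname{diag}\left\{\frac{\lambda}{2\sigma_1^2},\frac{\lambda}{2\sigma_1^2},\frac{\lambda}{2\sigma_2^2},\frac{\lambda}{2\sigma_2^2},\dots,\frac{\lambda}{2\sigma_{n-1}^2},\frac{\lambda}{2\sigma_{n-1}^2},\frac{\lambda}{2},\frac{\lambda}{2},\delta\right\},$$ where $\delta=\left(\sum_{k=1}^{n-1}\frac{-\lambda}{2\sigma_k^2}\right)-\frac{\lambda}{2}$.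
   Context: The Heisenberg Lie algebra $\mathfrak{h}_{2n+1}$ is the real Lie algebra with basis $\{f_1,g_1,\dots,f_n,g_n,z\}$ whose only nonzero brackets of basis elements (up to antisymmetry) are $[f_i,g_i]=z$, $i=1,\dots,n$. For $n=1$ there are no $\sigma_k$. A Lorentzian inner product is a nondegenerate symmetric bilinear form of signature $(2n,1)$; an orthonormal basis $\{v_1,\dots,v_m\}$ satisfies $\langle v_i,v_j\rangle=0$ for $i\ne j$, $\langle v_i,v_i\rangle=1$ for $i<m$, and $\langle v_m,v_m\rangle=-1$. The Levi-Civita connection of $(\mathfrak{g},\langle\cdot,\cdot\rangle)$ is the bilinear map $(u,v)\mapsto\nabla_uv$ on $\mathfrak{g}$ determined by the Koszul formula $2\langle\nabla_uv,w\rangle=\langle[u,v],w\rangle+\langle[w,u],v\rangle+\langle[w,v],u\rangle$. The curvature is $R_{uv}w=\nabla_{[u,v]}w-\nabla_u\nabla_vw+\nabla_v\nabla_uw$, and the Ricci operator is $\operatorname{Ric}(u)=\sum_{k=1}^{m}\langle v_k,v_k\rangle R_{v_ku}v_k$ for an orthonormal basis $\{v_1,\dots,v_m\}$. *)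

(* Defs.v *)
From HB Require Import structures.
From mathcomp Require Import all_boot all_order all_algebra.
From mathcomp Require Import reals.

Set Implicit Arguments.
Unset Strict Implicit.
Unset Printing Implicit Defensive.

Import GRing.Theory Num.Theory.
Local Open Scope ring_scope.

(* The tuple (a 1, b 1, a 2, b 2, ..., a n, b n, c); the values of a and b
   outside 1, ..., n are irrelevant. *)
Definition interleave_seq (T : Type) (n : nat) (a b : nat -> T) (c : T) : seq T :=
  rcons (flatten [seq [:: a k; b k] | k <- iota 1 n]) c.

Fact interleave_size (T : Type) (n : nat) (a b : nat -> T) (c : T) :
  size (interleave_seq n a b c) == n.*2.+1.
Proof.
rewrite size_rcons size_flatten eqSS /shape -map_comp.
by elim: n 1%N => [|n IHn] m //=; rewrite (eqP (IHn m.+1)) doubleS.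
Qed.

Definition interleave (T : Type) (n : nat) (a b : nat -> T) (c : T) :
  (n.*2.+1).-tuple T := Tuple (interleave_size n a b c).

Section Definitions.
Variables (R : realType) (V : vectType R).

Definition lie_bracket (br : {bilinear V -> V -> V}) : Prop :=
  (forall x, br x x = 0) /\
  (forall x y w, br x (br y w) + br y (br w x) + br w (br x y) = 0).

(* (V, br) is the Heisenberg Lie algebra of dimension 2n+1, with basis
   (f 1, g 1, ..., f n, g n, z). *)
Definition heisenberg (br : {bilinear V -> V -> V}) (n : nat)
    (f g : nat -> V) (z : V) : Prop :=
  [/\ lie_bracket br,
      basis_of {:V} (interleave n f g z),
      forall i j, (1 <= i <= n)%N -> (1 <= j <= n)%N ->
        [/\ br (f i) (f j) = 0, br (g i) (g j) = 0
          & br (f i) (g j) = if i == j then z else 0]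
    & forall i, (1 <= i <= n)%N -> br (f i) z = 0 /\ br (g i) z = 0].

Definition gram (mu : {symmetric V}) (m : nat) (e : m.-tuple V) : 'M[R]_m :=
  \matrix_(i, j) mu (tnth e i) (tnth e j).

(* Orthonormal basis for the Lorentzian signature (m, 1), the timelike vector
   being the last one. *)
Definition orthonormal_basis (mu : {symmetric V}) (m : nat)
    (v : (m.+1).-tuple V) : Prop :=
  basis_of {:V} v /\
  gram mu v = diag_mx (\row_i (if i == ord_max then -1 else 1)).

(* The bilinear map nabla is the Levi-Civita connection (Koszul formula). *)
Definition levi_civita (br : {bilinear V -> V -> V}) (mu : {symmetric V})
    (nabla : {bilinear V -> V -> V}) : Prop :=
  forall u v w, 2 * mu (nabla u v) w =
    mu (br u v) w + mu (br w u) v + mu (br w v) u.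

Definition curvature (br nabla : {bilinear V -> V -> V}) (u v w : V) : V :=
  nabla (br u v) w - nabla u (nabla v w) + nabla v (nabla u w).

(* The Ricci operator, computed in the orthonormal basis w. *)
Definition ricci (br nabla : {bilinear V -> V -> V}) (mu : {symmetric V})
    (m : nat) (w : m.-tuple V) (u : V) : V :=
  \sum_(k < m) mu (tnth w k) (tnth w k) *:
    curvature br nabla (tnth w k) u (tnth w k).

Fact ricci_linear (br nabla : {bilinear V -> V -> V}) (mu : {symmetric V})
    (m : nat) (w : m.-tuple V) : linear (ricci br nabla mu w).
Proof.
move=> a x y; rewrite /ricci scaler_sumr -big_split /=.
apply: eq_bigr => k _; rewrite scalerA mulrC -scalerA -scalerDr; congr (_ *: _).
rewrite /curvature !linearDr !linearZr_LR !linearDl !linearZl_LR.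
rewrite !linearDr !linearZr_LR opprD !scalerDr scalerN /=.
by rewrite [X in X + _ = _]addrACA [LHS]addrACA.
Qed.

HB.instance Definition _ br nabla mu m (w : m.-tuple V) :=
  GRing.isSemilinear.Build R V V _ (ricci br nabla mu w)
    (GRing.semilinear_linear (ricci_linear br nabla mu w)).

(* Matrix of phi in the basis e: column j lists the coordinates of
   phi (e j).  The library's mxof uses the transposed convention and requires
   a tuple indexed by \dim {:V}. *)
Definition operator_mx (m : nat) (e : m.-tuple V) (phi : {linear V -> V}) :
    'M[R]_m :=
  \matrix_(i, j) coord e i (phi (tnth e j)).

End Definitions.

(* Main.v *)
Require Import Defs.
From HB Require Import structures.
From mathcomp Require Import all_boot all_order all_algebra.
From mathcomp Require Import reals.
From mathcomp Require Import zify ring.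

Set Implicit Arguments.
Unset Strict Implicit.
Unset Printing Implicit Defensive.

Import Order.TTheory GRing.Theory Num.Theory.
Local Open Scope ring_scope.

(** Let c be the norm of z and s k the common norm of f k and g k, all nonzero;
    in the theorem c = - lambda and s n = 1.

    The value of the Ricci operator at u is the metric trace of the bilinear map
    (x, y) |-> R(x, u) y.  A metric trace
    sum_i B(e_i, e_i) / mu(e_i, e_i) takes the same value in every orthogonal
    basis ([form_trace_basis]); for an orthonormal one the weight equals its own
    inverse, being 1 or -1.  Hence the Ricci operator can be computed in the
    unnormalised basis (f k, g k, z), where no square roots appear
    ([ricci_orthogonal]).

    In that basis the Koszul formula gives a short table for the connection:
    [nabla (f k) (g k) = z / 2], [nabla (g k) (f k) = - z / 2],
    [nabla (f k) z = nabla z (f k) = - c / (2 s k) g k],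
    [nabla (g k) z = nabla z (g k) = c / (2 s k) f k], and zero otherwise.
    Only planes that contain z, or are spanned by some f k and g k, contribute
    to the trace.  On f k (and likewise on g k) the plane (f k, g k) contributes
    - 3 c / (4 s k ^ 2) and the plane (f k, z) contributes c / (4 s k ^ 2), which
    add up to - c / (2 s k ^ 2) ([ricci_f], [ricci_g]).  On z each of the 2 n
    planes (f k, z), (g k, z) contributes c / (4 s k ^ 2) ([ricci_z]).

    So the basis vectors are eigenvectors, and this remains true, with the same
    eigenvalues, after they are normalised. *)

(** * Positions in an interleaved tuple *)

(** These are the positions of [a k] and [b k] in [interleave n a b c], for
    k between 1 and n; the entries are counted from 0 and k from 1. *)
Definition left_slot (n k : nat) : 'I_(n.*2.+1) := inord k.-1.*2.
Definition right_slot (n k : nat) : 'I_(n.*2.+1) := inord k.-1.*2.+1.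

(** Case analysis on this predicate replaces an arbitrary position by one of
    the three shapes on which the entries of every interleaved tuple are known,
    whatever the type of its entries. *)
Variant slot_spec (n : nat) : 'I_(n.*2.+1) -> Prop :=
| LeftSlot k of (1 <= k <= n)%N : slot_spec (left_slot n k)
| RightSlot k of (1 <= k <= n)%N : slot_spec (right_slot n k)
| LastSlot : slot_spec ord_max.

Section Slots.
Variable n : nat.

Lemma left_slotE k : (1 <= k <= n)%N -> left_slot n k = k.-1.*2 :> nat.
Proof. by move=> hk; rewrite inordK //; lia. Qed.

Lemma right_slotE k : (1 <= k <= n)%N -> right_slot n k = k.-1.*2.+1 :> nat.
Proof. by move=> hk; rewrite inordK //; lia. Qed.

Lemma slotP (i : 'I_(n.*2.+1)) : slot_spec i.
Proof.
have [lt_in|le_ni] := ltnP i n.*2; last first.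
  suff -> : i = ord_max by constructor.
  by apply: val_inj => /=; have := ltn_ord i; lia.
have hk : (1 <= i./2.+1 <= n)%N by lia.
have := odd_double_half i; case: (odd i) => /= iE.
- suff -> : i = right_slot n i./2.+1 by constructor.
  by apply: val_inj; rewrite /= right_slotE //=; lia.
- suff -> : i = left_slot n i./2.+1 by constructor.
  by apply: val_inj; rewrite /= left_slotE //=; lia.
Qed.

Lemma left_slot_eq k l : (1 <= k <= n)%N -> (1 <= l <= n)%N ->
  (left_slot n k == left_slot n l) = (k == l).
Proof. by move=> hk hl; rewrite -val_eqE /= !left_slotE //; lia. Qed.

Lemma right_slot_eq k l : (1 <= k <= n)%N -> (1 <= l <= n)%N ->
  (right_slot n k == right_slot n l) = (k == l).
Proof. by move=> hk hl; rewrite -val_eqE /= !right_slotE //; lia. Qed.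

Lemma left_right_slot k l : (1 <= k <= n)%N -> (1 <= l <= n)%N ->
  left_slot n k != right_slot n l.
Proof.
by move=> hk hl; rewrite -val_eqE /= left_slotE // right_slotE //; lia.
Qed.

Lemma left_last_slot k : (1 <= k <= n)%N -> left_slot n k != ord_max.
Proof. by move=> hk; rewrite -val_eqE /= left_slotE //; lia. Qed.

Lemma right_last_slot k : (1 <= k <= n)%N -> right_slot n k != ord_max.
Proof. by move=> hk; rewrite -val_eqE /= right_slotE //; lia. Qed.

Section Entries.
Variables (T : Type) (a b : nat -> T) (c : T).

Let pairs m p := flatten [seq [:: a k; b k] | k <- iota m p].

Lemma size_flatten_pairs m p : size (pairs m p) = p.*2.
Proof. by rewrite /pairs; elim: p m => [|p IHp] m //=; rewrite IHp. Qed.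

(** The boolean records the parity of the position, so that one induction
    treats both members of a pair. *)
Lemma nth_flatten_pairs x0 m p j (e : bool) : (j < p)%N ->
  nth x0 (pairs m p) (e + j.*2) = if e then b (m + j) else a (m + j).
Proof.
rewrite /pairs; elim: p m j => [|p IHp] m [|j] //= lt_jp.
  by rewrite addn0; case: (e).
by rewrite doubleS !addnS /= -addSn IHp.
Qed.

Lemma tnth_left k : (1 <= k <= n)%N ->
  tnth (interleave n a b c) (left_slot n k) = a k.
Proof.
move=> hk; rewrite (tnth_nth c) left_slotE //= nth_rcons size_flatten_pairs.
have -> : (k.-1.*2 < n.*2)%N by lia.
rewrite -[k.-1.*2]/(false + k.-1.*2)%N nth_flatten_pairs; last by lia.
by congr a; lia.
Qed.

Lemma tnth_right k : (1 <= k <= n)%N ->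
  tnth (interleave n a b c) (right_slot n k) = b k.
Proof.
move=> hk; rewrite (tnth_nth c) right_slotE //= nth_rcons size_flatten_pairs.
have -> : (k.-1.*2.+1 < n.*2)%N by lia.
rewrite -[k.-1.*2.+1]/(true + k.-1.*2)%N nth_flatten_pairs; last by lia.
by congr b; lia.
Qed.

Lemma tnth_last : tnth (interleave n a b c) ord_max = c.
Proof. by rewrite (tnth_nth c) /= nth_rcons size_flatten_pairs ltnn eqxx. Qed.

End Entries.

Lemma sum_slots (U : nmodType) (F : 'I_(n.*2.+1) -> U) :
  \sum_i F i =
  \sum_(1 <= k < n.+1) (F (left_slot n k) + F (right_slot n k)) + F ord_max.
Proof.
(* Listing the values of F makes t a tuple whose sum can be taken pairwise. *)
pose t := interleave n (F \o left_slot n) (F \o right_slot n) (F ord_max).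
transitivity (\sum_i tnth t i).
  apply: eq_bigr => i _; rewrite /t.
  by case: (slotP i) => [k hk|k hk|]; rewrite ?tnth_left ?tnth_right ?tnth_last.
rewrite -(big_tuple _ _ t xpredT id) big_rcons big_flatten big_map /=.
rewrite /index_iota subn1; congr (_ + _).
by apply: eq_bigr => k _; rewrite !big_cons big_nil addr0.
Qed.

Lemma sum_nat_single (U : nmodType) (F : nat -> U) j : (1 <= j <= n)%N ->
    (forall k, (1 <= k <= n)%N -> k != j -> F k = 0) ->
  \sum_(1 <= k < n.+1) F k = F j.
Proof.
move=> hj F0; rewrite (bigD1_seq j) ?iota_uniq ?mem_index_iota //=.
by rewrite big_nat_cond big1 ?addr0 // => k /andP[]; rewrite ltnS; apply: F0.
Qed.

End Slots.

(** * Orthogonal bases *)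

Section OrthogonalBasis.
Variables (R : realType) (V : vectType R) (mu : {symmetric V}).

Lemma form_sym x y : mu x y = mu y x.
Proof. by rewrite hermC expr0 mul1r. Qed.

(** The general lemmas on bilinear maps leave [mu] seen through its underlying
    bilinear map, which hides it from later rewriting; hence these versions. *)
Lemma form0l y : mu 0 y = 0.
Proof. exact: linear0l. Qed.

Lemma formZl a x y : mu (a *: x) y = a * mu x y.
Proof. exact: linearZl_LR. Qed.

Lemma formZr a x y : mu x (a *: y) = a * mu x y.
Proof. by rewrite form_sym formZl form_sym. Qed.

Lemma form_suml m (E : 'I_m -> V) y : mu (\sum_i E i) y = \sum_i mu (E i) y.
Proof. exact: linear_sumlz. Qed.

Definition orthogonal_basis (m : nat) (e : m.-tuple V) : Prop :=
  [/\ basis_of {:V} e,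
      forall i j, i != j -> mu (tnth e i) (tnth e j) = 0
    & forall i, mu (tnth e i) (tnth e i) != 0].

Lemma gram_diagP m (e : m.-tuple V) (d : 'rV[R]_m) :
  gram mu e = diag_mx d <->
  forall i j, mu (tnth e i) (tnth e j) = d 0 i *+ (i == j).
Proof.
split=> [ed i j|ed]; first by have /matrixP/(_ i j) := ed; rewrite !mxE.
by apply/matrixP=> i j; rewrite !mxE ed.
Qed.

Lemma gram_diag_orthogonal m (e : m.-tuple V) (d : 'rV[R]_m) :
  basis_of {:V} e -> gram mu e = diag_mx d -> (forall i, d 0 i != 0) ->
  orthogonal_basis e.
Proof.
move=> be /gram_diagP ed d0; split=> // [i j /negPf ij|i].
  by rewrite ed ij mulr0n.
by rewrite ed eqxx mulr1n.
Qed.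

Lemma orthogonal_coord m (e : m.-tuple V) (a : 'I_m -> R) i :
    (forall i j, i != j -> mu (tnth e i) (tnth e j) = 0) ->
  mu (\sum_j a j *: tnth e j) (tnth e i) = a i * mu (tnth e i) (tnth e i).
Proof.
move=> eo; rewrite form_suml (bigD1 i) //= formZl big1 ?addr0 //.
by move=> j ji; rewrite formZl eo ?mulr0.
Qed.

Lemma orthogonal_basis_of m (e : m.-tuple V) :
    \dim {:V} = m ->
    (forall i j, i != j -> mu (tnth e i) (tnth e j) = 0) ->
    (forall i, mu (tnth e i) (tnth e i) != 0) ->
  basis_of {:V} e.
Proof.
move=> dimV eo e0; rewrite basisEfree subvf size_tuple dimV leqnn !andbT.
apply/freeP => a a0 i; apply: (mulIf (e0 i)).
rewrite mul0r -(orthogonal_coord _ _ eo).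
under eq_bigr do rewrite (tnth_nth 0).
by rewrite a0 form0l.
Qed.

Section Frame.
Variables (m : nat) (e : m.-tuple V).
Hypothesis he : orthogonal_basis e.

Lemma orthogonal_expansion x :
  x = \sum_i ((mu (tnth e i) (tnth e i))^-1 * mu x (tnth e i)) *: tnth e i.
Proof.
case: he => be eo e0.
have := coord_basis be (memvf x).
under eq_bigr do rewrite -tnth_nth.
move=> xE; rewrite {1}xE; apply: eq_bigr => i _; congr (_ *: _).
by rewrite [in mu x _]xE orthogonal_coord // mulrCA mulVf ?mulr1.
Qed.

Lemma orthogonal_eq x y :
  (forall i, mu x (tnth e i) = mu y (tnth e i)) -> x = y.
Proof.
move=> xy; rewrite [x]orthogonal_expansion [y]orthogonal_expansion.
by apply: eq_bigr => i _; rewrite xy.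
Qed.

End Frame.

(** This passes from a given orthogonal basis to a normalised one: rescaling
    keeps orthogonality and nonzero norms, and these force linear independence,
    so the rescaled family is again a basis. *)
Lemma orthogonal_rescale m (e v : m.-tuple V) (a : 'I_m -> R) :
    orthogonal_basis e -> (forall i, a i != 0) ->
    (forall i, tnth v i = a i *: tnth e i) ->
  basis_of {:V} v /\ gram mu v =
    diag_mx (\row_i (a i ^+ 2 * mu (tnth e i) (tnth e i))).
Proof.
move=> [be eo e0] a0 vE.
have vv i j : mu (tnth v i) (tnth v j) =
    (a i ^+ 2 * mu (tnth e i) (tnth e i)) *+ (i == j).
  rewrite !vE formZl formZr; case: eqVneq => [<-|ij].
    by rewrite mulr1n mulrA.
  by rewrite eo // !mulr0 mulr0n.
split; last by apply/gram_diagP => i j; rewrite vv mxE.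
apply: orthogonal_basis_of => [|i j /negPf ij|i].
- exact: size_basis be.
- by rewrite vv ij mulr0n.
- by rewrite vv eqxx mulr1n mulf_neq0 ?expf_neq0.
Qed.

(** The contraction of [B] with the metric, written in an orthogonal basis:
    dividing by the norms makes a normalisation of the basis superfluous. *)
Definition form_trace (W : lmodType R) (B : V -> V -> W)
    (m : nat) (e : m.-tuple V) : W :=
  \sum_i (mu (tnth e i) (tnth e i))^-1 *: B (tnth e i) (tnth e i).

(** Expand one argument of each B(e_i, e_i) along w and exchange the sums: for
    each k, the second arguments of B(w_k, _) then add up to the expansion of
    w_k along e. *)
Lemma form_trace_basis (W : lmodType R) (B : {bilinear V -> V -> W})
    (m p : nat) (e : m.-tuple V) (w : p.-tuple V) :
  orthogonal_basis e -> orthogonal_basis w ->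
  form_trace B e = form_trace B w.
Proof.
move=> he hw; rewrite /form_trace.
under eq_bigr => i _ do
  rewrite [X in B X _](orthogonal_expansion hw) linear_sumlz scaler_sumr.
rewrite exchange_big /=; apply: eq_bigr => k _.
rewrite [X in _ = _ *: B _ X](orthogonal_expansion he) linear_sumr scaler_sumr.
apply: eq_bigr => i _.
by rewrite linearZl_LR linearZr_LR !scalerA form_sym mulrCA mulrA.
Qed.

End OrthogonalBasis.

(** * The Ricci operator as a trace *)

Section Ricci.
Variables (R : realType) (V : vectType R).
Variables (br nabla : {bilinear V -> V -> V}) (mu : {symmetric V}).

(** The arguments of the curvature are reordered so that the trace runs over the
    last two. *)
Definition ricci_form (u x y : V) : V := curvature br nabla x u y.

Fact ricci_form_bilinear u : bilinear_for *:%R *:%R (ricci_form u).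
Proof.
split=> [y a x x'|x a y y']; rewrite /ricci_form /curvature /=.
  rewrite !linearPl linearPr scalerDr scalerBr opprD.
  by rewrite [X in X + _ = _]addrACA [LHS]addrACA.
rewrite !linearPr scalerDr scalerBr opprD.
by rewrite [X in X + _ = _]addrACA [LHS]addrACA.
Qed.

HB.instance Definition _ u :=
  @bilinear_isBilinear.Build R V V V *:%R *:%R (ricci_form u)
    (ricci_form_bilinear u).

Lemma orthonormal_orthogonal m (w : m.+1.-tuple V) :
  orthonormal_basis mu w -> orthogonal_basis mu w.
Proof.
case=> bw ww; apply: gram_diag_orthogonal bw ww _ => i; rewrite mxE.
by case: ifP => _; rewrite ?oppr_eq0 oner_eq0.
Qed.

(** The definition of the Ricci operator weighs the terms by the norms, the
    trace by their inverses; in an orthonormal basis these agree.  The trace may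
    then be moved to any orthogonal basis. *)
Lemma ricci_orthogonal m p (w : m.+1.-tuple V) (e : p.-tuple V) u :
  orthonormal_basis mu w -> orthogonal_basis mu e ->
  ricci br nabla mu w u = form_trace mu (ricci_form u) e.
Proof.
move=> hw he.
rewrite (form_trace_basis _ he (orthonormal_orthogonal hw)).
case: hw => _ /gram_diagP ww; apply: eq_bigr => k _; congr (_ *: _).
by rewrite ww eqxx mulr1n mxE; case: ifP => _; rewrite ?invrN invr1.
Qed.

(** As mu is nondegenerate, to compute [nabla u v] it suffices to guess the
    value and to test the Koszul formula on a basis. *)
Lemma levi_civita_unique m (e : m.-tuple V) u v t :
    levi_civita br mu nabla -> orthogonal_basis mu e ->
    (forall i, 2 * mu t (tnth e i) =
      mu (br u v) (tnth e i) + mu (br (tnth e i) u) v + mu (br (tnth e i) v) u) ->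
  nabla u v = t.
Proof.
move=> lc he ht; apply: (orthogonal_eq he) => i.
by apply: (@mulfI _ 2); rewrite ?pnatr_eq0 // lc ht.
Qed.

End Ricci.

(** * Operators with a basis of eigenvectors *)

Lemma operator_mx_eigenbasis (R : realType) (V : vectType R) m
    (v : m.-tuple V) (phi : {linear V -> V}) (r : 'I_m -> R) :
    free v -> (forall j, phi (tnth v j) = r j *: tnth v j) ->
  operator_mx v phi = diag_mx (\row_i r i).
Proof.
move=> fv vr; apply/matrixP => i j; rewrite !mxE vr linearZ /= (tnth_nth 0).
rewrite coord_free // eq_sym; case: eqVneq => [->|_]; first by rewrite mulr1.
by rewrite mulr0 mulr0n.
Qed.

(** * Diagonal metrics on the Heisenberg algebra *)

Section DiagonalMetric.
Variables (R : realType) (V : vectType R) (n : nat).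
Variables (br nabla : {bilinear V -> V -> V}) (mu : {symmetric V}).
Variables (f g : nat -> V) (z : V) (s : nat -> R) (c : R).
Hypothesis hheis : heisenberg br n f g z.
Hypothesis hmu : gram mu (interleave n f g z) =
  diag_mx (\row_i tnth (interleave n s s c) i).
Hypothesis s_neq0 : forall k, (1 <= k <= n)%N -> s k != 0.
Hypothesis c_neq0 : c != 0.
Hypothesis lc : levi_civita br mu nabla.

Local Notation in_range k := (1 <= k <= n)%N.
Local Notation e := (interleave n f g z).

Lemma heisenberg_orthogonal : orthogonal_basis mu e.
Proof.
case: hheis => _ be _ _; apply: gram_diag_orthogonal be hmu _ => i.
rewrite mxE; case: (slotP i) => [k hk|k hk|];
  by rewrite ?tnth_left ?tnth_right ?tnth_last ?s_neq0.
Qed.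

Let mu_slots i j : mu (tnth e i) (tnth e j) =
  tnth (interleave n s s c) i *+ (i == j).
Proof. by have /gram_diagP -> := hmu; rewrite mxE. Qed.

Lemma mu_ff k l : in_range k -> in_range l -> mu (f k) (f l) = s k *+ (k == l).
Proof.
move=> hk hl; have := mu_slots (left_slot n k) (left_slot n l).
by rewrite !tnth_left // left_slot_eq.
Qed.

Lemma mu_gg k l : in_range k -> in_range l -> mu (g k) (g l) = s k *+ (k == l).
Proof.
move=> hk hl; have := mu_slots (right_slot n k) (right_slot n l).
by rewrite !tnth_right // right_slot_eq.
Qed.

Lemma mu_fg k l : in_range k -> in_range l -> mu (f k) (g l) = 0.
Proof.
move=> hk hl; have := mu_slots (left_slot n k) (right_slot n l).
by rewrite !tnth_left // !tnth_right // (negPf (left_right_slot hk hl)).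
Qed.

Lemma mu_gf k l : in_range k -> in_range l -> mu (g k) (f l) = 0.
Proof. by move=> hk hl; rewrite form_sym mu_fg. Qed.

Lemma mu_fz k : in_range k -> mu (f k) z = 0.
Proof.
move=> hk; have := mu_slots (left_slot n k) ord_max.
by rewrite !tnth_left // !tnth_last (negPf (left_last_slot hk)).
Qed.

Lemma mu_gz k : in_range k -> mu (g k) z = 0.
Proof.
move=> hk; have := mu_slots (right_slot n k) ord_max.
by rewrite !tnth_right // !tnth_last (negPf (right_last_slot hk)).
Qed.

Lemma mu_zf k : in_range k -> mu z (f k) = 0.
Proof. by move=> hk; rewrite form_sym mu_fz. Qed.

Lemma mu_zg k : in_range k -> mu z (g k) = 0.
Proof. by move=> hk; rewrite form_sym mu_gz. Qed.

Lemma mu_zz : mu z z = c.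
Proof. by have := mu_slots ord_max ord_max; rewrite !tnth_last eqxx. Qed.

Lemma br_anti x y : br x y = - br y x.
Proof.
case: hheis => [[alt _] _ _ _]; apply/eqP; rewrite -addr_eq0; apply/eqP.
by have := alt (x + y); rewrite linearDl !linearDr !alt add0r addr0.
Qed.

Lemma br_ff k l : in_range k -> in_range l -> br (f k) (f l) = 0.
Proof. by case: hheis => _ _ + _ hk hl => /(_ k l hk hl)[]. Qed.

Lemma br_gg k l : in_range k -> in_range l -> br (g k) (g l) = 0.
Proof. by case: hheis => _ _ + _ hk hl => /(_ k l hk hl)[]. Qed.

(** A scalar in place of the case distinction lets the Kronecker symbol pass
    through the bilinear maps and the field identities below. *)
Lemma br_fg k l : in_range k -> in_range l -> br (f k) (g l) = (k == l)%:R *: z.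
Proof.
case: hheis => _ _ + _ hk hl => /(_ k l hk hl)[_ _ ->].
by case: eqP; rewrite ?scale1r ?scale0r.
Qed.

Lemma br_gf k l : in_range k -> in_range l ->
  br (g k) (f l) = - (l == k)%:R *: z.
Proof. by move=> hk hl; rewrite br_anti br_fg // scaleNr. Qed.

Lemma br_fz k : in_range k -> br (f k) z = 0.
Proof. by case: hheis => _ _ _ + hk => /(_ k hk)[]. Qed.

Lemma br_gz k : in_range k -> br (g k) z = 0.
Proof. by case: hheis => _ _ _ + hk => /(_ k hk)[]. Qed.

Lemma br_zf k : in_range k -> br z (f k) = 0.
Proof. by move=> hk; rewrite br_anti br_fz // oppr0. Qed.

Lemma br_zg k : in_range k -> br z (g k) = 0.
Proof. by move=> hk; rewrite br_anti br_gz // oppr0. Qed.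

Lemma br_zz : br z z = 0.
Proof. by case: hheis => [[alt _] _ _ _]. Qed.

Definition br_table :=
  (br_ff, br_gg, br_fg, br_gf, br_fz, br_gz, br_zf, br_zg, br_zz).
Definition mu_table :=
  (mu_ff, mu_gg, mu_fg, mu_gf, mu_fz, mu_gz, mu_zf, mu_zg, mu_zz).

Lemma koszul_slots u v t :
    let koszul x := 2 * mu t x = mu (br u v) x + mu (br x u) v + mu (br x v) u in
    (forall k, in_range k -> koszul (f k)) ->
    (forall k, in_range k -> koszul (g k)) ->
    koszul z ->
  nabla u v = t.
Proof.
move=> koszul hf hg hz.
apply: (levi_civita_unique lc heisenberg_orthogonal) => i.
by case: (slotP i) => [k hk|k hk|]; rewrite ?tnth_left ?tnth_right ?tnth_last //;
  [exact: hf | exact: hg].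
Qed.

(** Tests a guessed value of the connection on the basis; what remains is the
    scalar identity that is not 0 = 0, if there is one. *)
Ltac koszul :=
  apply: koszul_slots => [m hm|m hm|];
  rewrite ?br_table // ?formZl ?form0l ?mu_table //= ?mulr0 ?addr0 //.

Lemma nabla_ff k l : in_range k -> in_range l -> nabla (f k) (f l) = 0.
Proof. by move=> hk hl; koszul. Qed.

Lemma nabla_gg k l : in_range k -> in_range l -> nabla (g k) (g l) = 0.
Proof. by move=> hk hl; koszul. Qed.

Lemma nabla_fg k l : in_range k -> in_range l ->
  nabla (f k) (g l) = ((k == l)%:R / 2) *: z.
Proof. by move=> hk hl; koszul; field. Qed.

Lemma nabla_gf k l : in_range k -> in_range l ->
  nabla (g k) (f l) = - ((l == k)%:R / 2) *: z.
Proof. by move=> hk hl; koszul; field. Qed.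

Lemma nabla_fz k : in_range k -> nabla (f k) z = - (c / (2 * s k)) *: g k.
Proof.
move=> hk; koszul; have sk := s_neq0 hk.
by case: eqP => _; rewrite ?mulr1n ?mulr0n; field.
Qed.

Lemma nabla_zf k : in_range k -> nabla z (f k) = - (c / (2 * s k)) *: g k.
Proof.
move=> hk; koszul; have sk := s_neq0 hk.
by case: eqP => _; rewrite ?mulr1n ?mulr0n; field.
Qed.

Lemma nabla_gz k : in_range k -> nabla (g k) z = (c / (2 * s k)) *: f k.
Proof.
move=> hk; koszul; have sk := s_neq0 hk.
by rewrite eq_sym; case: eqP => _; rewrite ?mulr1n ?mulr0n; field.
Qed.

Lemma nabla_zg k : in_range k -> nabla z (g k) = (c / (2 * s k)) *: f k.
Proof.
move=> hk; koszul; have sk := s_neq0 hk.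
by rewrite eq_sym; case: eqP => _; rewrite ?mulr1n ?mulr0n; field.
Qed.

Lemma nabla_zz : nabla z z = 0.
Proof. by koszul. Qed.

(** The trace that gives the Ricci operator at f j runs over all k, so the
    curvature is needed for two independent indices; the factor that vanishes
    unless j = k reduces the trace to a single term. *)
Lemma curvature_fff k j : in_range k -> in_range j ->
  curvature br nabla (f k) (f j) (f k) = 0.
Proof.
move=> hk hj.
by rewrite /curvature br_ff // !nabla_ff // linear0l !linear0r subr0 addr0.
Qed.

Lemma curvature_ggg k j : in_range k -> in_range j ->
  curvature br nabla (g k) (g j) (g k) = 0.
Proof.
move=> hk hj.
by rewrite /curvature br_gg // !nabla_gg // linear0l !linear0r subr0 addr0.
Qed.

Lemma curvature_gfg k j : in_range k -> in_range j ->
  curvature br nabla (g k) (f j) (g k) =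
  ((j == k)%:R * (- 3 * c / (4 * s k))) *: f k.
Proof.
move=> hk hj; have sk := s_neq0 hk.
rewrite /curvature br_gf // nabla_fg // nabla_gg // linear0r addr0.
rewrite linearZl_LR linearZr_LR /= nabla_zg // nabla_gz // !scalerA -scalerBl.
by congr (_ *: _); field.
Qed.

Lemma curvature_fgf k j : in_range k -> in_range j ->
  curvature br nabla (f k) (g j) (f k) =
  ((k == j)%:R * (- 3 * c / (4 * s k))) *: g k.
Proof.
move=> hk hj; have sk := s_neq0 hk.
rewrite /curvature br_fg // nabla_gf // nabla_ff // linear0r addr0.
rewrite linearZl_LR linearZr_LR /= nabla_zf // nabla_fz // !scalerA -scalerBl.
by congr (_ *: _); field.
Qed.

Lemma curvature_zfz j : in_range j ->
  curvature br nabla z (f j) z = (c ^+ 2 / (4 * s j ^+ 2)) *: f j.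
Proof.
move=> hj; have sj := s_neq0 hj.
rewrite /curvature br_zf // nabla_fz // nabla_zz linear0l linear0r addr0 sub0r.
rewrite linearZr_LR /= nabla_zg // scalerA -scaleNr.
by congr (_ *: _); field.
Qed.

Lemma curvature_zgz j : in_range j ->
  curvature br nabla z (g j) z = (c ^+ 2 / (4 * s j ^+ 2)) *: g j.
Proof.
move=> hj; have sj := s_neq0 hj.
rewrite /curvature br_zg // nabla_gz // nabla_zz linear0l linear0r addr0 sub0r.
rewrite linearZr_LR /= nabla_zf // scalerA -scaleNr.
by congr (_ *: _); field.
Qed.

Lemma curvature_fzf k : in_range k ->
  curvature br nabla (f k) z (f k) = (c / (4 * s k)) *: z.
Proof.
move=> hk; have sk := s_neq0 hk.
rewrite /curvature br_fz // nabla_zf // nabla_ff //.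
rewrite linear0l linear0r addr0 sub0r.
rewrite linearZr_LR /= nabla_fg // eqxx mulr1n scalerA -scaleNr.
by congr (_ *: _); field.
Qed.

Lemma curvature_gzg k : in_range k ->
  curvature br nabla (g k) z (g k) = (c / (4 * s k)) *: z.
Proof.
move=> hk; have sk := s_neq0 hk.
rewrite /curvature br_gz // nabla_zg // nabla_gg //.
rewrite linear0l linear0r addr0 sub0r.
rewrite linearZr_LR /= nabla_gf // eqxx mulr1n scalerA -scaleNr.
by congr (_ *: _); field.
Qed.

Lemma curvature_zzz : curvature br nabla z z z = 0.
Proof. by rewrite /curvature br_zz linear0l sub0r addNr. Qed.

Lemma form_trace_heisenberg (B : V -> V -> V) :
  form_trace mu B e =
  \sum_(1 <= k < n.+1) (s k)^-1 *: (B (f k) (f k) + B (g k) (g k))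
  + c^-1 *: B z z.
Proof.
rewrite /form_trace sum_slots tnth_last mu_zz; congr (_ + _).
apply: eq_big_nat => k; rewrite ltnS => hk.
by rewrite tnth_left // tnth_right // mu_ff // mu_gg // eqxx mulr1n scalerDr.
Qed.

Section RicciValues.
Variables (m : nat) (w : m.+1.-tuple V).
Hypothesis hw : orthonormal_basis mu w.

(** The pair (f j, g j) contributes - 3 c / (4 s j ^ 2), and the direction of z
    contributes c / (4 s j ^ 2). *)
Lemma ricci_f j : in_range j ->
  ricci br nabla mu w (f j) = (- c / (2 * s j ^+ 2)) *: f j.
Proof.
move=> hj; have sj := s_neq0 hj.
rewrite (ricci_orthogonal _ _ _ hw heisenberg_orthogonal) form_trace_heisenberg.
rewrite /ricci_form (sum_nat_single hj); last first.
  move=> k hk kj; rewrite curvature_fff // curvature_gfg // eq_sym (negPf kj).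
  by rewrite mul0r scale0r addr0 scaler0.
rewrite curvature_fff // curvature_gfg // curvature_zfz // eqxx mulr1n add0r.
rewrite !scalerA -scalerDl; congr (_ *: _); field.
by rewrite sj c_neq0.
Qed.

Lemma ricci_g j : in_range j ->
  ricci br nabla mu w (g j) = (- c / (2 * s j ^+ 2)) *: g j.
Proof.
move=> hj; have sj := s_neq0 hj.
rewrite (ricci_orthogonal _ _ _ hw heisenberg_orthogonal) form_trace_heisenberg.
rewrite /ricci_form (sum_nat_single hj); last first.
  move=> k hk kj; rewrite curvature_ggg // curvature_fgf // (negPf kj).
  by rewrite mul0r scale0r addr0 scaler0.
rewrite curvature_ggg // curvature_fgf // curvature_zgz // eqxx mulr1n addr0.
rewrite !scalerA -scalerDl; congr (_ *: _); field.
by rewrite sj c_neq0.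
Qed.

Lemma ricci_z :
  ricci br nabla mu w z = (\sum_(1 <= k < n.+1) c / (2 * s k ^+ 2)) *: z.
Proof.
rewrite (ricci_orthogonal _ _ _ hw heisenberg_orthogonal) form_trace_heisenberg.
rewrite /ricci_form curvature_zzz scaler0 addr0 scaler_suml.
apply: eq_big_nat => k; rewrite ltnS => hk.
have sk := s_neq0 hk.
rewrite curvature_fzf // curvature_gzg // -scalerDl scalerA.
by congr (_ *: _); field.
Qed.

End RicciValues.

End DiagonalMetric.

Theorem theorem3p3 (R : realType) (n : nat) (lambda : R) (sigma : nat -> R)
    (hn : (1 <= n)%N) (hlambda : 0 < lambda)
    (hsigma_ge1 : forall k, (1 <= k < n)%N -> 1 <= sigma k)
    (hsigma_noninc : forall k l, (1 <= k)%N -> (k <= l)%N -> (l < n)%N ->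
       sigma l <= sigma k)
    (V : vectType R) (br : {bilinear V -> V -> V}) (f g : nat -> V) (z : V)
    (hheis : heisenberg br n f g z)
    (mu : {symmetric V})
    (hmu : gram mu (interleave n f g z) =
       let s k := if (k < n)%N then sigma k else 1 in
       diag_mx (\row_i tnth (interleave n s s (- lambda)) i))
    (nabla : {bilinear V -> V -> V}) (hnabla : levi_civita br mu nabla)
    (w : (n.*2.+1).-tuple V) (hw : orthonormal_basis mu w) :
  let v := interleave n
    (fun k => if (k < n)%N then (Num.sqrt (sigma k))^-1 *: f k else f k)
    (fun k => if (k < n)%N then (Num.sqrt (sigma k))^-1 *: g k else g k)
    ((Num.sqrt lambda)^-1 *: z) in
  let r k := if (k < n)%N then lambda / (2 * sigma k ^+ 2) else lambda / 2 in
  let delta := \sum_(1 <= k < n) (- lambda / (2 * sigma k ^+ 2)) - lambda / 2 in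
  orthonormal_basis mu v /\
  operator_mx v (ricci br nabla mu w) =
    diag_mx (\row_i tnth (interleave n r r delta) i).
Proof.
move=> v r delta.
pose s k := if (k < n)%N then sigma k else 1.
pose e := interleave n f g z.
have s_gt0 k : (1 <= k <= n)%N -> 0 < s k.
  rewrite /s => hk; case: ifP => // kn.
  by apply: lt_le_trans (hsigma_ge1 k _) => //; lia.
have s_neq0 k hk : s k != 0 := lt0r_neq0 (s_gt0 k hk).
have c_neq0 : - lambda != 0 by rewrite oppr_eq0 lt0r_neq0.
have he : orthogonal_basis mu e.
  exact: (heisenberg_orthogonal hheis hmu s_neq0 c_neq0).
(* As s n = 1, the same formula gives the scaling factor for every k. *)
pose q k := (Num.sqrt (s k))^-1.
pose a i := tnth (interleave n q q (Num.sqrt lambda)^-1) i.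
have vE i : tnth v i = a i *: tnth e i.
  rewrite /a /v /e /q /s.
  case: (slotP i) => [k hk|k hk|]; rewrite ?tnth_left ?tnth_right ?tnth_last //;
    by case: ifP => // _; rewrite sqrtr1 invr1 scale1r.
have a_neq0 i : a i != 0.
  rewrite /a; case: (slotP i) => [k hk|k hk|];
    rewrite ?tnth_left ?tnth_right ?tnth_last // invr_eq0 sqrtr_eq0 -ltNge;
    by rewrite ?s_gt0.
have [bv vv] := orthogonal_rescale he a_neq0 vE.
split.
  split=> //; rewrite vv; congr diag_mx; apply/rowP => i; rewrite !mxE /a /e.
  case: (slotP i) => [k hk|k hk|].
  - rewrite !tnth_left // (mu_ff hmu) // eqxx mulr1n exprVn.
    rewrite sqr_sqrtr ?ltW ?s_gt0 // mulVf ?s_neq0 //.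
    by rewrite (negPf (left_last_slot hk)).
  - rewrite !tnth_right // (mu_gg hmu) // eqxx mulr1n exprVn.
    rewrite sqr_sqrtr ?ltW ?s_gt0 // mulVf ?s_neq0 //.
    by rewrite (negPf (right_last_slot hk)).
  - rewrite !tnth_last (mu_zz hmu) eqxx exprVn sqr_sqrtr ?ltW //.
    by rewrite mulrN mulVf ?lt0r_neq0.
pose rho i := tnth (interleave n r r delta) i.
apply: (operator_mx_eigenbasis (r := rho) (basis_free bv)) => j.
rewrite vE linearZ /= [RHS]scalerA [rho j * _]mulrC -scalerA /rho.
congr (_ *: _).
have rE k : r k = - - lambda / (2 * s k ^+ 2).
  by rewrite /r /s opprK; case: ifP => // _; rewrite expr1n mulr1.
case: (slotP j) => [k hk|k hk|].
- rewrite !tnth_left // rE.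
  exact: (ricci_f hheis hmu s_neq0 c_neq0 hnabla hw).
- rewrite !tnth_right // rE.
  exact: (ricci_g hheis hmu s_neq0 c_neq0 hnabla hw).
- rewrite !tnth_last (ricci_z hheis hmu s_neq0 c_neq0 hnabla hw).
  congr (_ *: _); rewrite big_nat_recr //= /delta /s ltnn expr1n mulr1 mulNr.
  by congr (_ - _); apply: eq_big_nat => k /andP[_ ->].
Qed.
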